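(* Let $g:\mathbb R^m\to\mathbb R\cup\{+\infty\}$ be proper, lsc and convex, let $H:\mathbb R^n\to\mathbb R^m$ be continuously differentiable, and let $\omega:\mathbb R^m\to\mathbb R$ be convex and continuously differentiable with Lipschitz gradient. Suppose $\omega$ is 1-coercive with $\omega(0)\le0$, and put $s_g(y,\mu):=(g\#\omega_\mu)(y)$. Then $s_f:(x,\mu)\mapsto s_g(H(x),\mu)$ is an epi-smoothing function for $f:=g\circ H$, and $$\operatorname*{Lim\,sup}_{\mu\downarrow0,\,x\to\bar x}\nabla_xs_f(x,\mu)=\partial f(\bar x)$$ for all $\bar x\in\operatorname{dom}f$ at which the basic constraint qualification (BCQ) holds.
   Context: Lsc means lower semicontinuous; $\operatorname{dom} f=\{x\mid f(x)<+\infty\}$; proper means nonempty domain. For $\mu>0$, $\omega_\mu(y):=\mu\,\omega(y/\mu)$ and $(g\#\omega_\mu)(y):=\inf_{u\in\mathbb R^m}\{g(u)+\omega_\mu(y-u)\}$. $\omega$ is 1-coercive if $\lim_{\|y\|\to\infty}\omega(y)/\|y\|=+\infty$. The notation $\mu_k\downarrow0$ means $\mu_k>0$, $\mu_k\to0$. BCQ at $\bar x\in\operatorname{dom}f$: $N(H(\bar x)\mid\operatorname{dom}g)\cap\operatorname{nul}H'(\bar x)^T=\{0\}$, where $H'$ is the Jacobian, $\operatorname{nul}$ denotes the null space, and for a convex set $C$ and $\bar y\in C$, $N(\bar y\mid C)=\{v\mid v^T(y-\bar y)\le0\ \forall y\in C\}$. Subdifferentials: the regular subdifferential of $f$ at $x\in\operatorname{dom}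 f$ is $\hat\partial f(x)=\{v\mid f(z)\ge f(x)+v^T(z-x)+o(\|z-x\|)\}$. The limiting subdifferential $\partial f(\bar x)$ is the set of all $v$ for which there exist $x^k\to\bar x$ with $f(x^k)\to f(\bar x)$ and $v^k\in\hat\partial f(x^k)$ with $v^k\to v$. Epi-smoothing function: for $f:\mathbb R^n\to\mathbb R\cup\{+\infty\}$ lsc, $s_f:\mathbb R^n\times\mathbb R_+\to\mathbb R$ is an epi-smoothing function for $f$ if (i) for every $\mu_k\downarrow0$, $s_f(\cdot,\mu_k)$ epi-converges to $f$, i.e. for every $\bar x$: $\liminf_k s_f(x^k,\mu_k)\ge f(\bar x)$ for all $x^k\to\bar x$, and there is $x^k\to\bar x$ with $\limsup_k s_f(x^k,\mu_k)\le f(\bar x)$; and (ii) $s_f(\cdot,\mu)$ is (real-valued and) continuously differentiable for all $\mu>0$. Only values for $\mu>0$ matter; values at $\mu=0$ are irrelevant. $\operatorname*{Lim\,sup}_{\mu\downarrow 0,x\to\bar x}\nabla_xs_f(x,\mu)$ is the set of all $v$ for which there exist $x^k\to\bar x$ and $\mu_k\downarrow0$ with $\nabla_xs_f(x^k,\mu_k)\to v$. *)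

(* Defs.v *)
From HB Require Import structures.
From mathcomp Require Export all_boot all_order all_algebra.
From mathcomp Require Export all_classical all_reals all_analysis.

Set Implicit Arguments.
Unset Strict Implicit.
Unset Printing Implicit Defensive.

Import Order.TTheory GRing.Theory Num.Theory.
Import numFieldNormedType.Exports.

Local Open Scope classical_set_scope.
Local Open Scope ring_scope.

(* Vectors of R^n are row vectors 'rV[R]_n.  Functions with values in
   R \cup {+oo} are maps into \bar R that never take the value -oo. *)

Definition dot (R : realType) (n : nat) (u v : 'rV[R]_n) : R :=
  \sum_i u 0 i * v 0 i.

(* The norm `|x| of the library on 'rV[R]_n is the max norm; it only serves
   for the (identical) topology. *)
Definition enorm (R : realType) (n : nat) (x : 'rV[R]_n) : R :=
  Num.sqrt (dot x x).

Definition dom (R : realType) (n : nat) (f : 'rV[R]_n -> \bar R)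
  : set 'rV[R]_n := [set x | (f x < +oo)%E].

Definition avoids_ninfty (R : realType) (n : nat) (f : 'rV[R]_n -> \bar R)
  : Prop := forall x, (-oo < f x)%E.

Definition proper_fun (R : realType) (n : nat) (f : 'rV[R]_n -> \bar R)
  : Prop := dom f !=set0.

(* For t = 0 or t = 1 the convention 0 * +oo = 0 makes the inequality trivial. *)
Definition convex_efun (R : realType) (n : nat) (f : 'rV[R]_n -> \bar R)
  : Prop := forall (x y : 'rV[R]_n) (t : R), 0 <= t <= 1 ->
    (f (t *: x + (1 - t) *: y)%R <= t%:E * f x + (1 - t)%R%:E * f y)%E.

Definition grad (R : realType) (n : nat) (h : 'rV[R]_n -> R) (x : 'rV[R]_n)
  : 'rV[R]_n := \row_i 'D_(delta_mx 0 i) h x.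

Definition continuously_differentiable (R : realType) (n : nat)
    (h : 'rV[R]_n -> R) : Prop :=
  (forall x, differentiable h x) /\ continuous (grad h).

(* 'J H x acts on row vectors from the right, 'd H x u = u *m 'J H x: it is the
   transpose of the usual m x n Jacobian matrix H'(x). *)
Definition continuously_differentiable_map (R : realType) (n m : nat)
    (H : 'rV[R]_n -> 'rV[R]_m) : Prop :=
  (forall x, differentiable H x) /\ continuous (fun x => 'J H x).

Definition lipschitz_map (R : realType) (n m : nat)
    (F : 'rV[R]_n -> 'rV[R]_m) : Prop :=
  exists L : R, forall x y, enorm (F x - F y) <= L * enorm (x - y).

Definition one_coercive (R : realType) (m : nat) (omega : 'rV[R]_m -> R)
  : Prop := forall A : R, exists r : R, forall y : 'rV[R]_m,
    r < enorm y -> A < omega y / enorm y.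

Definition rescale (R : realType) (m : nat) (omega : 'rV[R]_m -> R) (mu : R)
  : 'rV[R]_m -> R := fun y => mu * omega (mu^-1 *: y).

Definition infconv (R : realType) (m : nat) (g : 'rV[R]_m -> \bar R)
    (h : 'rV[R]_m -> R) : 'rV[R]_m -> \bar R :=
  fun y => ereal_inf (range (fun u => (g u + (h (y - u)%R)%:E)%E)).

Definition normal_cone (R : realType) (m : nat) (C : set 'rV[R]_m)
    (ybar : 'rV[R]_m) : set 'rV[R]_m :=
  [set v | forall y, C y -> dot v (y - ybar) <= 0].

(* In column notation, H'(xbar)^T v is the transpose of v *m ('J H xbar)^T. *)
Definition BCQ (R : realType) (n m : nat) (g : 'rV[R]_m -> \bar R)
    (H : 'rV[R]_n -> 'rV[R]_m) (xbar : 'rV[R]_n) : Prop :=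
  normal_cone (dom g) (H xbar) `&` [set v | v *m ('J H xbar)^T = 0] = [set 0].

Definition regular_subdiff (R : realType) (n : nat) (f : 'rV[R]_n -> \bar R)
    (x : 'rV[R]_n) : set 'rV[R]_n :=
  [set v | dom f x /\ forall e : R, 0 < e -> \forall z \near x,
    (f x + (dot v (z - x) - e * enorm (z - x))%R%:E <= f z)%E].

Definition limiting_subdiff (R : realType) (n : nat) (f : 'rV[R]_n -> \bar R)
    (xbar : 'rV[R]_n) : set 'rV[R]_n :=
  [set v | exists (xs vs : nat -> 'rV[R]_n),
    [/\ xs k @[k --> \oo] --> xbar,
        f (xs k) @[k --> \oo] --> f xbar,
        forall k, regular_subdiff f (xs k) (vs k)
      & vs k @[k --> \oo] --> v]].

Definition decreases_to0 (R : realType) (mu : nat -> R) : Prop :=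
  (forall k, 0 < mu k) /\ mu k @[k --> \oo] --> (0 : R).

Definition epi_converges (R : realType) (n : nat)
    (fs : nat -> 'rV[R]_n -> \bar R) (f : 'rV[R]_n -> \bar R) : Prop :=
  forall xbar : 'rV[R]_n,
    (forall xs : nat -> 'rV[R]_n, xs k @[k --> \oo] --> xbar ->
      (f xbar <= limn_einf (fun k => fs k (xs k)))%E) /\
    (exists2 xs : nat -> 'rV[R]_n, xs k @[k --> \oo] --> xbar &
      (limn_esup (fun k => fs k (xs k)) <= f xbar)%E).

(* s is allowed to be extended-real-valued a priori (as an infimal convolution
   is); finiteness for mu > 0 is part of the definition.  The values s x mu for
   mu <= 0 are never used. *)
Definition epi_smoothing (R : realType) (n : nat) (f : 'rV[R]_n -> \bar R)
    (s : 'rV[R]_n -> R -> \bar R) : Prop :=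
  [/\ avoids_ninfty f,
      lower_semicontinuous f,
      forall mu : nat -> R, decreases_to0 mu ->
        epi_converges (fun k x => s x (mu k)) f
    & forall mu : R, 0 < mu ->
        (forall x, s x mu \is a fin_num) /\
        continuously_differentiable (fun x => fine (s x mu))].

Definition Limsup_grad (R : realType) (n : nat) (s : 'rV[R]_n -> R -> \bar R)
    (xbar : 'rV[R]_n) : set 'rV[R]_n :=
  [set v | exists (xs : nat -> 'rV[R]_n) (mu : nat -> R),
    [/\ xs k @[k --> \oo] --> xbar,
        decreases_to0 mu
      & grad (fun x => fine (s x (mu k))) (xs k) @[k --> \oo] --> v]].

(* Main.v *)
Require Import Defs.
From HB Require Import structures.
From mathcomp Require Import all_boot all_order all_algebra.
From mathcomp Require Import all_classical all_reals all_analysis.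
From mathcomp Require Import ring lra.
Import Order.TTheory GRing.Theory Num.Theory.
Import numFieldNormedType.Exports.
Local Open Scope classical_set_scope.
Local Open Scope ring_scope.

(** Write e_mu for the envelope g # omega_mu, so that the smoothing of
    f = g o H is x |-> e_mu (H x).

    Smoothness.  A convex lsc proper g has a minorant of linear growth
    [convex_lsc_linear_minorant] and omega grows faster than any linear
    function, so the infimum defining e_mu y is attained at some p
    [infconv_attained].  The function z |-> g p + omega_mu (z - p) then lies
    above e_mu and touches it at y.  Since the gradient of omega is Lipschitz,
    this majorant is in turn below a quadratic with the same value and slope at
    y; a convex function touched from above by a quadratic of fixed curvature
    at every point is C^1, even with Lipschitz gradient [convex_touch_C1].

    Epi-convergence.  From omega 0 <= 0 one gets e_mu <= g.  Conversely, if
    alpha < g y then alpha <= e_mu z for z near y and mu near 0, because the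
    superlinear penalty omega_mu makes every u at a fixed distance from z too
    expensive [envelope_lower_limit]. 

    Limits of gradients are subgradients [multiplier_limit].  Let
    w_k = grad e_(mu_k) (H x_k) and suppose that w_k H'(x_k) tends to v.
    Convexity and e_mu <= g give
        e_(mu_k) (H x_k) + <w_k, u - H x_k> <= g u    for u in dom g.
    If |w_k| were unbounded, dividing by it would produce in the limit a unit
    vector normal to dom g and annihilated by the Jacobian, against the
    constraint qualification.  So w_k has a cluster point w, and the lower
    bound on e_mu turns the displayed inequality into the statement that w is
    a subgradient of g at H xbar.  Then v = w H'(xbar) is a regular
    subgradient of f at xbar itself [regular_subdiff_comp].

    Subgradients are limits of gradients [regular_subdiff_approx].  A
    regular subgradient v0 of f at x0 makes f - <v0, . - x0> plus a small
    quadratic penalty larger on a small sphere than at x0.  By the two bounds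
    above and compactness of the sphere this persists when f is replaced by
    its smoothing, which therefore has an interior critical point of the
    perturbed function; there its gradient is close to v0.

    Estimates are made in the max norm `|.|; the Euclidean norm of the
    definitions is compared with it by [norm_le_enorm] and
    [enorm_le_norm]. *)

Set Implicit Arguments.
Unset Strict Implicit.
Unset Printing Implicit Defensive.

(** * The inner product and the two norms *)

Lemma dotE (R : realType) (n : nat) (u v : 'rV[R]_n) : dot u v = (u *m v^T) 0 0.
Proof. by rewrite /dot mxE; apply: eq_bigr => i _; rewrite mxE. Qed.

Lemma dotC (R : realType) (n : nat) (u v : 'rV[R]_n) : dot u v = dot v u.
Proof. by apply: eq_bigr => i _; rewrite mulrC. Qed.

Lemma dotDl (R : realType) (n : nat) (u v w : 'rV[R]_n) :
  dot (u + v) w = dot u w + dot v w.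
Proof. by rewrite !dotE mulmxDl mxE. Qed.

Lemma dotDr (R : realType) (n : nat) (u v w : 'rV[R]_n) :
  dot w (u + v) = dot w u + dot w v.
Proof. by rewrite dotC dotDl !(dotC w). Qed.

Lemma dotZl (R : realType) (n : nat) (a : R) (u v : 'rV[R]_n) :
  dot (a *: u) v = a * dot u v.
Proof. by rewrite !dotE -scalemxAl mxE. Qed.

Lemma dotZr (R : realType) (n : nat) (a : R) (u v : 'rV[R]_n) :
  dot u (a *: v) = a * dot u v.
Proof. by rewrite dotC dotZl dotC. Qed.

Lemma dotNl (R : realType) (n : nat) (u v : 'rV[R]_n) : dot (- u) v = - dot u v.
Proof. by rewrite -scaleN1r dotZl mulN1r. Qed.

Lemma dotNr (R : realType) (n : nat) (u v : 'rV[R]_n) : dot u (- v) = - dot u v.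
Proof. by rewrite dotC dotNl dotC. Qed.

Lemma dot0r (R : realType) (n : nat) (u : 'rV[R]_n) : dot u 0 = 0.
Proof. by rewrite -(scale0r 0) dotZr mul0r. Qed.

Lemma dotBl (R : realType) (n : nat) (u v w : 'rV[R]_n) :
  dot (u - v) w = dot u w - dot v w.
Proof. by rewrite dotDl dotNl. Qed.

Lemma dotBr (R : realType) (n : nat) (u v w : 'rV[R]_n) :
  dot w (u - v) = dot w u - dot w v.
Proof. by rewrite dotDr dotNr. Qed.

Lemma dot_mulmxl (R : realType) (n m : nat) (w : 'rV[R]_m) (A : 'M[R]_(n, m))
  (u : 'rV[R]_n) : dot (w *m A^T) u = dot w (u *m A).
Proof. by rewrite !dotE trmx_mul mulmxA. Qed.

Lemma coord_le_norm (R : realType) (n : nat) (u : 'rV[R]_n) i : `|u 0 i| <= `|u|.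
Proof.
rewrite [leRHS]/Num.Def.normr /= mx_normrE.
by apply/bigmax_geP; right => /=; exists (0, i).
Qed.

Lemma norm_le_coord (R : realType) (n : nat) (u : 'rV[R]_n) (M : R) :
  0 <= M -> (forall i, `|u 0 i| <= M) -> `|u| <= M.
Proof.
move=> M0 uM; rewrite [leLHS]/Num.Def.normr /= mx_normrE.
by apply/bigmax_leP; split => // -[i j] _ /=; rewrite ord1.
Qed.

Lemma norm_dot_le (R : realType) (n : nat) (u v : 'rV[R]_n) :
  `|dot u v| <= n%:R * `|u| * `|v|.
Proof.
rewrite /dot (le_trans (ler_norm_sum _ _ _))//.
rewrite (@le_trans _ _ (\sum_(i < n) (`|u| * `|v|)))//.
  apply: ler_sum => i _; rewrite normrM.
  by rewrite ler_pM ?normr_ge0 ?coord_le_norm.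
by rewrite sumr_const card_ord -mulrA mulr_natl.
Qed.

Lemma dot_le (R : realType) (n : nat) (u v : 'rV[R]_n) :
  dot u v <= n%:R * `|u| * `|v|.
Proof. by rewrite (le_trans (ler_norm _))// norm_dot_le. Qed.

Lemma dot_ge (R : realType) (n : nat) (u v : 'rV[R]_n) :
  - (n%:R * `|u| * `|v|) <= dot u v.
Proof. by have := norm_dot_le u v; rewrite ler_norml => /andP[]. Qed.

Lemma dot_ge0 (R : realType) (n : nat) (u : 'rV[R]_n) : 0 <= dot u u.
Proof. by apply: sumr_ge0 => i _; rewrite -expr2 sqr_ge0. Qed.

Lemma sqr_norm_le_dot (R : realType) (n : nat) (u : 'rV[R]_n) :
  `|u| ^+ 2 <= dot u u.
Proof.
rewrite -[leRHS]sqr_sqrtr ?dot_ge0// ler_sqr ?nnegrE ?sqrtr_ge0//.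
apply: norm_le_coord; first exact: sqrtr_ge0.
move=> i; rewrite -sqrtr_sqr ler_wsqrtr//.
rewrite /dot (bigD1 i)//= -expr2 lerDl.
by apply: sumr_ge0 => j _; rewrite -expr2 sqr_ge0.
Qed.

Lemma norm_le_enorm (R : realType) (n : nat) (u : 'rV[R]_n) : `|u| <= enorm u.
Proof.
by rewrite -[leLHS]ger0_norm// -sqrtr_sqr ler_wsqrtr// sqr_norm_le_dot.
Qed.

Lemma enorm_le_norm (R : realType) (n : nat) (u : 'rV[R]_n) :
  enorm u <= n%:R * `|u|.
Proof.
rewrite -[leRHS]ger0_norm ?mulr_ge0// -sqrtr_sqr ler_wsqrtr//.
rewrite (le_trans (dot_le _ _))// exprMn -mulrA -expr2.
apply: ler_wpM2r; first exact: sqr_ge0.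
by rewrite -natrX ler_nat; case: (n) => // k; rewrite expnS leq_pmulr// expn_gt0.
Qed.

(** * Convergence of matrices *)

Lemma cvg_sumr (R : realType) (T I : Type) (r : seq I) (F : set_system T)
    {FF : Filter F} (f : I -> T -> R) (l : I -> R) :
  (forall i, f i @ F --> l i) ->
  \sum_(i <- r) f i x @[x --> F] --> \sum_(i <- r) l i.
Proof.
move=> fl.
rewrite [X in X @ _ --> _](_ : _ = \sum_(i <- r) f i); last first.
  by apply/funext => x; rewrite fct_sumE.
elim/big_ind2 : _ => [|u p v q up vq|i _]; [exact: cvg_cst|exact: cvgD|exact: fl].
Qed.

(** Neighbourhoods of a matrix are generated by products of neighbourhoods
    of its entries, of which there are finitely many. *)
Lemma cvg_mx_coord (R : realType) (n m : nat) (T : Type) (F : set_system T)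
    {FF : Filter F} (f : T -> 'M[R]_(n, m)) (l : 'M[R]_(n, m)) :
  (forall i j, f x i j @[x --> F] --> l i j) -> f @ F --> l.
Proof.
move=> fl P [Q Ql QP].
suff : \forall x \near F, forall i j, Q i j (f x i j).
  by apply: filterS => x Qx; exact: QP.
apply: filter_forall => i; apply: filter_forall => j.
exact: (fl i j _ (Ql i j)).
Qed.

Lemma cvg_coord (R : realType) (n m : nat) (T : Type) (F : set_system T)
    {FF : Filter F} (f : T -> 'M[R]_(n, m)) (l : 'M[R]_(n, m)) i j :
  f @ F --> l -> f x i j @[x --> F] --> l i j.
Proof.
by move=> fl; apply: (cvg_comp f (fun M : 'M[R]_(n, m) => M i j) fl);
  exact: coord_continuous.
Qed.

Lemma cvg_mulmx (R : realType) (n m p : nat) (T : Type) (F : set_system T)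
    {FF : Filter F} (f : T -> 'M[R]_(n, m)) (g : T -> 'M[R]_(m, p))
    (a : 'M[R]_(n, m)) (b : 'M[R]_(m, p)) :
  f @ F --> a -> g @ F --> b -> f x *m g x @[x --> F] --> a *m b.
Proof.
move=> fa gb; apply: cvg_mx_coord => i j; rewrite mxE.
under eq_fun do rewrite mxE.
by apply: cvg_sumr => k; apply: cvgM; exact: cvg_coord.
Qed.

Lemma cvg_trmx (R : realType) (n m : nat) (T : Type) (F : set_system T)
    {FF : Filter F} (f : T -> 'M[R]_(n, m)) (a : 'M[R]_(n, m)) :
  f @ F --> a -> (f x)^T @[x --> F] --> a^T.
Proof.
move=> fa; apply: cvg_mx_coord => i j; rewrite mxE.
by under eq_fun do rewrite mxE; exact: cvg_coord.
Qed.

Lemma cvg_dot (R : realType) (n : nat) (T : Type) (F : set_system T)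
    {FF : Filter F} (u v : T -> 'rV[R]_n) (a b : 'rV[R]_n) :
  u @ F --> a -> v @ F --> b -> dot (u x) (v x) @[x --> F] --> dot a b.
Proof. by move=> ua vb; apply: cvg_sumr => i; apply: cvgM; exact: cvg_coord. Qed.

(** * Gradients *)

(** Linearity in the form required for [dot w] to serve as a differential.
    *)
Fact dot_is_linear (R : realType) (n : nat) (w : 'rV[R]_n) :
  GRing.linear_for *:%R (dot w : 'rV[R]_n -> R^o).
Proof. by move=> a u v; rewrite dotDr dotZr. Qed.

HB.instance Definition _ (R : realType) (n : nat) (w : 'rV[R]_n) :=
  GRing.isLinear.Build R 'rV[R]_n R^o *:%R (dot w : 'rV[R]_n -> R^o)
    (dot_is_linear w).

Lemma diff_grad (R : realType) (n : nat) (h : 'rV[R]_n -> R) (x u : 'rV[R]_n) :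
  differentiable h x -> 'd h x u = dot (grad h x) u.
Proof.
move=> dh; rewrite {1}(row_sum_delta u) linear_sum /dot.
apply: eq_bigr => i _; rewrite linearZ mxE deriveE//.
by rewrite mulrC.
Qed.

Lemma diff_expansion (R : realType) (n : nat) (h : 'rV[R]_n -> R) (x : 'rV[R]_n) :
  differentiable h x -> forall e : R, 0 < e -> \forall u \near (0 : 'rV[R]_n),
    `|h (x + u) - h x - dot (grad h x) u| <= e * `|u|.
Proof.
move=> dh e e0; have /eqaddoP/(_ _ e0) := diff_locally dh.
apply: filterS => u /=.
by rewrite !fctE diff_grad// opprD addrA [u + x]addrC.
Qed.

Lemma dot_delta (R : realType) (n : nat) (w : 'rV[R]_n) i :
  dot w (delta_mx 0 i) = w 0 i.
Proof.
rewrite /dot (bigD1 i)//= mxE !eqxx mulr1 big1 ?addr0// => j ji.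
by rewrite mxE (negbTE ji) andbF mulr0.
Qed.

(** A first-order expansion determines both differentiability and the
    gradient, because differentials are unique. *)
Lemma differentiable_expansion (R : realType) (n : nat) (h : 'rV[R]_n -> R)
    (x w : 'rV[R]_n) :
  (forall e : R, 0 < e -> \forall u \near (0 : 'rV[R]_n),
    `|h (x + u) - h x - dot w u| <= e * `|u|) ->
  differentiable h x /\ grad h x = w.
Proof.
move=> hw.
have dotC0 : continuous (dot w).
  move=> u; apply: (@cvg_dot R n _ (nbhs u) _ (cst w) id w u).
    exact: cvg_cst.
  exact: cvg_id.
have hE : h \o shift x = (cst (h x) : 'rV[R]_n -> R^o) + dot w +o_ (0 : 'rV[R]_n) id.
  apply/eqaddoP => e e0; apply: filterS (hw e e0) => u /=.
  by rewrite !fctE opprD addrA [u + x]addrC.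
have dE := @diff_unique R 'rV[R]_n R h (dot w) x dotC0 hE.
have dh : differentiable h x by apply/diff_locallyP; rewrite dE.
split=> //; apply/rowP => i; rewrite mxE deriveE// dE.
exact: dot_delta.
Qed.

(** Replacing u by - u turns the inequality of two linear forms into
    equality. *)
Lemma dot_delta_le (R : realType) (n : nat) (a b : 'rV[R]_n) :
  (forall u, dot a u <= dot b u) -> a = b.
Proof.
move=> ab; apply/rowP => i; apply/eqP; rewrite eq_le.
have := ab (delta_mx 0 i); have := ab (- delta_mx 0 i).
by rewrite !dotNr lerN2 !dot_delta => -> ->.
Qed.

(** A one-sided bound along a ray with a quadratic error determines a bound
    on the directional derivative. With K = 0 it serves convex functions, with K
    > 0 minimizers of a function plus a quadratic penalty. *)
Lemma derivative_ge (R : realType) (n : nat) (h : 'rV[R]_n -> R)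
    (x u : 'rV[R]_n) (c K : R) : differentiable h x -> 0 <= K ->
  (\forall t \near (0 : R)^'+, h x + t * c - K * t ^+ 2 <= h (x + t *: u)) ->
  c <= dot (grad h x) u.
Proof.
move=> dh K0 hc; apply/ler_addgt0Pr => e e0.
pose e1 := e / 2 / (`|u| + 1).
have u1 : 0 < `|u| + 1 by rewrite ltr_wpDl.
have e1_gt0 : 0 < e1 by rewrite !divr_gt0.
have /nbhs_norm0P[r /= r0 hr] := diff_expansion dh e1_gt0.
have K1 : 0 < K + 1 by rewrite ltr_wpDl.
near (0 : R)^'+ => t.
have t0 : 0 < t by near: t; exact: nbhs_right_gt.
have Kt : t < e / 2 / (K + 1).
  by near: t; apply: nbhs_right_lt; rewrite !divr_gt0.
have tr : t < r / (`|u| + 1) by near: t; apply: nbhs_right_lt; rewrite divr_gt0.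
have /hr /= : `|t *: u| < r.
  rewrite normrZ gtr0_norm//; move: tr; rewrite ltr_pdivlMr//; lra.
have : h x + t * c - K * t ^+ 2 <= h (x + t *: u) by near: t.
rewrite dotZr normrZ (gtr0_norm t0) => h1 /ler_normlP[_ h2].
have e1u : e1 * `|u| <= e / 2.
  have : e1 * (`|u| + 1) = e / 2 by rewrite /e1 divfK// gt_eqF.
  lra.
move: Kt; rewrite ltr_pdivlMr// => Kt.
rewrite -(ler_pM2l t0) mulrDr.
nra.
Unshelve. all: by end_near. Qed.

(** In row-vector notation the chain rule multiplies by the transpose of ['J
    H x], which acts from the right as the differential. *)
Lemma grad_comp (R : realType) (n m : nat) (h : 'rV[R]_m -> R)
    (H : 'rV[R]_n -> 'rV[R]_m) (x : 'rV[R]_n) :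
  differentiable H x -> differentiable h (H x) ->
  differentiable (h \o H) x /\
  grad (h \o H) x = grad h (H x) *m ('J H x)^T.
Proof.
move=> dH dh; have dhH := differentiable_comp dH dh; split=> //.
apply/rowP => i; rewrite mxE deriveE// diff_comp//= diff_grad//.
by rewrite -dot_delta dot_mulmxl /jacobian mul_rV_lin1.
Qed.

(** * Convex functions touched from above by quadratics *)

(** Convexity of finite functions with bare real weights; [convex_function]
    quantifies over the packaged interval type instead. *)
Definition convexf (R : realType) (m : nat) (E : 'rV[R]_m -> R) : Prop :=
  forall (x y : 'rV[R]_m) (t : R), 0 <= t <= 1 ->
    E (t *: x + (1 - t) *: y) <= t * E x + (1 - t) * E y.

(** Convexity bounds E from below on the ray leaving y away from z: y lies
    between z and y + t (y - z), hence E (y + t (y - z)) >= E y + t (E y - E z).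
    This bounds the derivative in direction y - z from below. *)
Lemma convex_grad_le (R : realType) (m : nat) (E : 'rV[R]_m -> R)
    (y z : 'rV[R]_m) : convexf E -> differentiable E y ->
  E y + dot (grad E y) (z - y) <= E z.
Proof.
move=> cE dE; suff : E y - E z <= dot (grad E y) (y - z).
  by rewrite -(opprB z y) dotNr; lra.
apply: (@derivative_ge _ _ _ _ _ _ 0) => //.
near=> t.
have t0 : 0 < t by near: t; exact: nbhs_right_gt.
have t1 : 1 + t != 0 by rewrite gt_eqF// ltr_wpDl.
(* s is the weight of y + t (y - z) in the combination with z that gives y. *)
pose s := (1 + t)^-1.
have st : s * (1 + t) = 1 by rewrite /s mulVf.
have s01 : 0 <= s <= 1.
  by rewrite /s invr_ge0 invf_le1 ?lerDl ?(ltW t0)// ?addr_ge0 ?ltr_wpDl// ltW.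
have := cE (y + t *: (y - z)) z s s01.
have -> : s *: (y + t *: (y - z)) + (1 - s) *: z = y.
  by apply/rowP => i; rewrite !mxE /s; field.
have s0 : 0 < s by rewrite invr_gt0 ltr_wpDl.
rewrite mul0r subr0 => h.
rewrite -(ler_pM2l s0) mulrDr mulrA.
have -> : s * t = 1 - s by lra.
lra.
Unshelve. all: by end_near. Qed.

(** The curvature C is uniform in y; for convex functions this is
    equivalent, up to constants, to having a Lipschitz gradient. *)
Definition quadratically_touched (R : realType) (m : nat) (h : 'rV[R]_m -> R)
    (C : R) : Prop :=
  forall y, exists w, forall z,
    h z <= h y + dot w (z - y) + C * `|z - y| ^+ 2.

(** The majorant bounds E (y + u) from above and E (y - u) as well; since E
    y is at most the mean of E (y + u) and E (y - u), the second bound becomes a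
    lower bound on E (y + u) with the same linear part. *)
Lemma convex_touch_differentiable (R : realType) (m : nat) (E : 'rV[R]_m -> R)
    (C : R) (y w : 'rV[R]_m) : convexf E -> 0 <= C ->
  (forall z, E z <= E y + dot w (z - y) + C * `|z - y| ^+ 2) ->
  differentiable E y /\ grad E y = w.
Proof.
move=> cE C0 Ew; apply: differentiable_expansion => e e0.
have C1 : 0 < C + 1 by rewrite ltr_wpDl.
apply/nbhs_norm0P; exists (e / (C + 1)); first by rewrite /= divr_gt0.
move=> u /=; rewrite ltr_pdivlMr// => ue.
have h1 := Ew (y + u); have h2 := Ew (y - u).
rewrite (addrC y) addrK in h1; rewrite (addrC y) addrK normrN dotNr in h2.
have := cE (u + y) (- u + y) (1 / 2).
have -> : (1 / 2) *: (u + y) + (1 - 1 / 2) *: (- u + y) = y.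
  by apply/rowP => i; rewrite !mxE; field.
have h01 : 0 <= (1 / 2 : R) <= 1 by lra.
move=> /(_ h01) h3.
have h4 : C * `|u| ^+ 2 <= e * `|u|.
  by have := normr_ge0 u; nra.
rewrite (addrC y) ler_norml; lra.
Qed.

(** The gradient is even Lipschitz. For two points y, y' with gradient
    difference D, compare at z = y' + t D the supporting hyperplane at y with
    the quadratic majorant at y', which gives t |D|^2 <= <D, y - y'> + C t^2
    |D|^2, and take t of order 1 / C. *)
Lemma convex_touch_C1 (R : realType) (m : nat) (E : 'rV[R]_m -> R) (C : R) :
  convexf E -> 0 <= C ->
  quadratically_touched E C -> continuously_differentiable E.
Proof.
move=> cE C0 Ew.
have Ed y : differentiable E y /\
    forall z, E z <= E y + dot (grad E y) (z - y) + C * `|z - y| ^+ 2.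
  have [w hw] := Ew y.
  by have [dE ->] := convex_touch_differentiable cE C0 hw.
split=> [y|]; first by case: (Ed y).
have C1 : 0 < C + 1 by rewrite ltr_wpDl.
have lip y y' : `|grad E y - grad E y'| <= 4 * (C + 1) * m%:R * `|y - y'|.
  pose D := grad E y - grad E y'; pose t := (2 * (C + 1))^-1.
  rewrite -/D.
  have tC : t * (C + 1) = 1 / 2.
    by rewrite /t; field; rewrite gt_eqF.
  have t0 : 0 < t by rewrite invr_gt0 mulr_gt0.
  have [dy _] := Ed y; have [dy' uy'] := Ed y'.
  have h1 := convex_grad_le (y' + t *: D) cE dy.
  have h2 := convex_grad_le y cE dy'.
  have h3 := uy' (y' + t *: D).
  have : t * dot D D <= dot D (y - y') + C * t ^+ 2 * `|D| ^+ 2.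
    move: h1 h2 h3; rewrite [y' + _ - y']addrC addKr normrZ (gtr0_norm t0).
    rewrite /D !(dotBl, dotBr, dotDr, dotZr, dotDl, dotZl).
    rewrite exprMn; lra.
  have h4 := sqr_norm_le_dot D; have h5 := dot_le D (y - y').
  have [->|D0] := eqVneq D 0; first by rewrite normr0 !mulr_ge0// ltW.
  have {}D0 : 0 < `|D| by rewrite normr_gt0.
  move=> h6.
  have h7 : t / 2 * `|D| ^+ 2 <= m%:R * `|D| * `|y - y'|.
    have : C * t ^+ 2 * `|D| ^+ 2 <= t / 2 * `|D| ^+ 2.
      by apply: ler_wpM2r; [exact: sqr_ge0|nra].
    have : t * `|D| ^+ 2 <= t * dot D D by rewrite ler_pM2l.
    lra.
  have {}h7 : t / 2 * `|D| <= m%:R * `|y - y'|.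
    by rewrite -(ler_pM2r D0); lra.
  have -> : `|D| = 4 * (C + 1) * (t / 2 * `|D|).
    have e2 : `|D| = 2 * (t * (C + 1)) * `|D| by rewrite tC; lra.
    by rewrite {1}e2; field.
  rewrite -(mulrA _ m%:R); apply: ler_wpM2l => //; lra.
move=> y; apply/(@cvgrPdist_lt _ 'rV[R]_m _ (nbhs y)) => e e0.
pose L := 4 * (C + 1) * m%:R.
have L1 : 0 < L + 1 by rewrite ltr_wpDl// !mulr_ge0// ltW.
apply/(@nbhs_normP _ 'rV[R]_m); exists (e / (L + 1)); first by rewrite /= divr_gt0.
move=> z /=; rewrite ltr_pdivlMr// => yz.
apply: le_lt_trans (lip y z) _; rewrite -/L.
by have := normr_ge0 (y - z); lra.
Qed.

(** * Lower semicontinuous functions *)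

Lemma ereal_dense (R : realType) (a : R) (x : \bar R) : (a%:E < x)%E ->
  exists2 b : R, a < b & (b%:E < x)%E.
Proof.
case: x => [r|_|//]; last by exists (a + 1); rewrite ?ltry// ltrDl.
by rewrite lte_fin => ar; exists ((a + r) / 2); rewrite ?lte_fin; lra.
Qed.

Lemma lscD_continuous (R : realType) (T : topologicalType) (f : T -> \bar R)
    (k : T -> R) : lower_semicontinuous f -> continuous k ->
  lower_semicontinuous (fun x => f x + (k x)%:E)%E.
Proof.
move=> flsc kc x a ax.
have /ereal_dense[b ab bf] : ((a - k x)%:E < f x)%E by rewrite EFinB lteBlDr.
have [V Vx fV] := flsc x b bf.
exists (V `&` [set z | a - b < k z]).
  apply: filterI => //.
  have : a - b < k x by lra.
  by move=> /(cvgr_gt _ (kc x)).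
move=> z [/fV + /= kz]; case: (f z) => [r|_|//]; last by rewrite ltry.
rewrite -EFinD !lte_fin; lra.
Qed.

(** Were no minimizer to exist, every p in K would admit q in K with f q < f
    p, and by lower semicontinuity f q < f near p. Along the filter generated by
    the sublevel sets of f on K, compactness makes this uniform: some q in K
    satisfies f q < f p for all p in K, and p = q is absurd. *)
Lemma lsc_compact_min (R : realType) (T : topologicalType) (f : T -> \bar R)
    (K : set T) : lower_semicontinuous f -> (forall x, (-oo < f x)%E) ->
  compact K -> K !=set0 -> exists2 p, K p & forall u, K u -> (f p <= f u)%E.
Proof.
move=> flsc fN cK [p0 Kp0]; apply: contrapT => nmin.
have lower p : K p -> exists2 q, K q & (f q < f p)%E.
  move=> Kp; apply: contrapT => nq; apply: nmin; exists p => // u Ku.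
  by rewrite leNgt; apply/negP => fup; apply: nq; exists u.
pose F : set_system T := filter_from K (fun p => [set q | K q /\ (f q <= f p)%E]).
have FF : Filter F.
  apply: filter_from_filter; first by exists p0.
  move=> p q Kp Kq; case: (leP (f p) (f q)) => pq.
    by exists p => // u [Ku up]; split; split => //; exact: le_trans pq.
  by exists q => // u [Ku uq]; split; split => //; exact: le_trans (ltW pq).
have /compact_near_coveringP/(_ T F (fun q p => (f q < f p)%E) FF) := cK.
case=> [p Kp|q Kq /= qK].
  have [q Kq qp] := lower p Kp.
  have fq : f q \is a fin_num.
    by rewrite fin_numE gt_eqF//= lt_eqF// (lt_le_trans qp)// leey.
  have [V Vp fV] : exists2 V, nbhs p V & forall y, V y -> (f q < f y)%E.
    by have := flsc p (fine (f q)); rewrite fineK//; exact.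
  exists (V, [set u | K u /\ (f u <= f q)%E]) => /=.
    by split=> //; exists q.
  by move=> [x u] /= [Vx [_ uq]]; rewrite (le_lt_trans uq)// fV.
by have := qK q (conj Kq (lexx _)) q Kq; rewrite ltxx.
Qed.

Lemma dist_continuous (R : realType) (m : nat) (y : 'rV[R]_m) :
  continuous (fun u : 'rV[R]_m => `|u - y|).
Proof.
move=> u.
apply: (@cvg_norm R 'rV[R]_m _ (nbhs u) _ (fun v => v - y)).
apply: (@cvgB R 'rV[R]_m _ (nbhs u) _ id (cst y)); [exact: cvg_id|exact: cvg_cst].
Qed.

Lemma compact_norm_ball (R : realType) (m : nat) (y : 'rV[R]_m) (r : R) :
  compact [set u : 'rV[R]_m | `|u - y| <= r].
Proof.
apply: bounded_closed_compact.
  exists (r + `|y|); split; first exact: num_real.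
  move=> M rM u /= ur; rewrite -(subrK y u) (le_trans (ler_normD _ _))//.
  by rewrite (le_trans _ (ltW rM))// lerD2r.
rewrite [X in closed X](_ : _ = (fun u : 'rV[R]_m => `|u - y|) @^-1` [set x | x <= r])//.
by apply: closed_comp => [u _|]; [exact: dist_continuous|exact: closed_le].
Qed.

Lemma compact_norm_sphere (R : realType) (m : nat) (y : 'rV[R]_m) (r : R) :
  compact [set u : 'rV[R]_m | `|u - y| = r].
Proof.
rewrite [X in compact X](_ : _ = [set u : 'rV[R]_m | `|u - y| <= r] `&`
   (fun u : 'rV[R]_m => `|u - y|) @^-1` [set x | r <= x]); last first.
  apply/seteqP; split=> u /=; first by move=> ->.
  by move=> [ur ru]; apply/eqP; rewrite eq_le ur.
apply: compact_closedI; first exact: compact_norm_ball.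
by apply: closed_comp => [u _|]; [exact: dist_continuous|exact: closed_ge].
Qed.

(** The function g is bounded below on the unit ball around a point u0 of
    its domain, and for u outside it the point of the segment from u0 to u at
    distance 1 from u0 transfers that bound to u with a factor |u - u0|. *)
Lemma convex_lsc_linear_minorant (R : realType) (m : nat)
    (g : 'rV[R]_m -> \bar R) : avoids_ninfty g -> proper_fun g ->
  lower_semicontinuous g -> convex_efun g ->
  exists a b : R, 0 <= b /\ forall u, ((- a - b * `|u|)%:E <= g u)%E.
Proof.
move=> gN [u0 gu0] glsc gcvx.
have [p /= Kp pmin] : exists2 p, [set u | `|u - u0| <= 1] p &
    forall u, [set u | `|u - u0| <= 1] u -> (g p <= g u)%E.
  apply: lsc_compact_min => //; first exact: compact_norm_ball.
  by exists u0; rewrite /= subrr normr0.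
have gp : g p \is a fin_num.
  rewrite fin_numE gt_eqF//= lt_eqF// (le_lt_trans _ gu0)// pmin//=.
  by rewrite subrr normr0.
have gu0f : g u0 \is a fin_num by rewrite fin_numE gt_eqF//= lt_eqF.
pose b := `|fine (g p)| + `|fine (g u0)|.
have b0 : 0 <= b by rewrite addr_ge0.
exists (b * (`|u0| + 1)), b; split=> // u.
have [ur|ur] := leP `|u - u0| 1.
  apply: le_trans (pmin u ur); rewrite -(fineK gp) lee_fin.
  have := ler_norm (- fine (g p)); rewrite normrN.
  have : 0 <= b * `|u0| by rewrite mulr_ge0.
  have : 0 <= b * `|u| by rewrite mulr_ge0.
  by have := normr_ge0 (fine (g u0)); rewrite /b; lra.
case: (g u) (gN u) (gcvx u u0) => [c _|_ _|//]; last by rewrite leey.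
set r := `|u - u0| in ur *.
have r0 : 0 < r by rewrite (lt_trans _ ur).
have t01 : 0 <= r^-1 <= 1 by rewrite invr_ge0 (ltW r0) invf_le1// ltW.
move=> /(_ _ t01); set q := _ + _ => gq.
have Kq : `|q - u0| <= 1.
  have -> : q - u0 = r^-1 *: (u - u0).
    by apply/rowP => i; rewrite !mxE; ring.
  by rewrite normrZ gtr0_norm ?invr_gt0// mulVf// gt_eqF.
have := le_trans (pmin q Kq) gq.
rewrite -(fineK gp) -(fineK gu0f) -!EFinM -EFinD !lee_fin => h.
have ru : r <= `|u| + `|u0| by rewrite ler_normB.
have : r * fine (g p) <= c + (r - 1) * fine (g u0).
  move: h; rewrite -(ler_pM2l r0) mulrDr mulrA mulfV ?gt_eqF// mul1r.
  by rewrite mulrA mulrBr mulfV ?gt_eqF// mulr1.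
have h1 : r * (- fine (g p)) <= r * `|fine (g p)|.
  by rewrite ler_pM2l// -normrN ler_norm.
have h2 : (r - 1) * fine (g u0) <= (r - 1) * `|fine (g u0)|.
  by apply: ler_wpM2l; [lra|exact: ler_norm].
have h3 : r * b <= (`|u| + `|u0|) * b by rewrite ler_wpM2r.
have := normr_ge0 (fine (g u0)); move: h3 b0; rewrite /b; lra.
Qed.

(** * Infimal convolution with a smooth superlinear kernel *)

(** Coercivity with an affine minorant of every slope, the form in which it
    is used; unlike a statement on the ratio h z / |z| at infinity it also
    controls h near the origin and scales well. *)
Definition superlinear (R : realType) (m : nat) (h : 'rV[R]_m -> R) : Prop :=
  forall A : R, 0 <= A -> exists c : R, forall z, A * `|z| - c <= h z.

Lemma infconv_le (R : realType) (m : nat) (g : 'rV[R]_m -> \bar R)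
    (h : 'rV[R]_m -> R) (y u : 'rV[R]_m) :
  (infconv g h y <= g u + (h (y - u))%:E)%E.
Proof. by apply: ereal_inf_lbound; exists u. Qed.

(** Against a minorant - a - b |u| of g, a kernel growing with slope b + 1
    makes the objective coercive, so that its minimum over a large ball is
    global. *)
Lemma infconv_attained (R : realType) (m : nat) (g : 'rV[R]_m -> \bar R)
    (h : 'rV[R]_m -> R) (y : 'rV[R]_m) :
  avoids_ninfty g -> proper_fun g -> lower_semicontinuous g -> convex_efun g ->
  continuous h -> superlinear h ->
  exists2 p, g p \is a fin_num &
    infconv g h y = (fine (g p) + h (y - p))%:E.
Proof.
move=> gN gP glsc gcvx hc hs.
have [a [b [b0 gab]]] := convex_lsc_linear_minorant gN gP glsc gcvx.
have b1 : 0 <= b + 1 by rewrite addr_ge0.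
have [c hbc] := hs _ b1.
have [u0 gu0] := gP.
have gu0f : g u0 \is a fin_num by rewrite fin_numE gt_eqF//= lt_eqF.
pose phi u := (g u + (h (y - u))%:E)%E.
have phiN u : (-oo < phi u)%E.
  by rewrite /phi; case: (g u) (gN u) => //= r _; rewrite ltNyr.
have hyc : continuous (fun u : 'rV[R]_m => h (y - u)).
  move=> u; apply: (cvg_comp (fun v : 'rV[R]_m => y - v) h); last exact: hc.
  by apply: (@cvgB R 'rV[R]_m _ (nbhs u) _ (cst y) id); [exact: cvg_cst|exact: cvg_id].
have philsc : lower_semicontinuous phi := lscD_continuous glsc hyc.
(* Outside this radius the coercive lower bound exceeds the value at u0. *)
pose rho := Num.max `|u0 - y| (fine (g u0) + h (y - u0) + a + b * `|y| + c).
have K0 : [set u : 'rV[R]_m | `|u - y| <= rho] u0 by rewrite /= le_max lexx.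
have [p /= Kp pmin] := lsc_compact_min philsc phiN (@compact_norm_ball R m y rho)
  (ex_intro _ _ K0).
have phip u : (phi p <= phi u)%E.
  have [/pmin//|ur] := leP `|u - y| rho.
  apply: le_trans (pmin u0 K0) _.
  apply: (@le_trans _ _ ((- a - b * `|u|)%:E + ((b + 1) * `|y - u| - c)%:E)%E).
    rewrite /phi -(fineK gu0f) -EFinD -EFinD lee_fin.
    move: ur; rewrite gt_max => /andP[_].
    have : b * `|u| <= b * (`|y| + `|y - u|).
      by apply: ler_wpM2l => //; rewrite -{1}(subKr y u) ler_normB.
    rewrite distrC; lra.
  by apply: leeD; [exact: gab|rewrite lee_fin; exact: hbc].
have gp : g p \is a fin_num.
  have := phip u0; rewrite /phi -(fineK gu0f) -EFinD.
  by case: (g p) (gN p) => [//|_|//]; rewrite addye// leye_eq.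
exists p => //; apply/eqP; rewrite eq_le; apply/andP; split.
  by rewrite EFinD fineK//; exact: infconv_le.
apply: le_ereal_inf_tmp => _ [u _ <-].
by rewrite EFinD fineK//; exact: phip.
Qed.

Lemma infconv_fin_num (R : realType) (m : nat) (g : 'rV[R]_m -> \bar R)
    (h : 'rV[R]_m -> R) (y : 'rV[R]_m) :
  avoids_ninfty g -> proper_fun g -> lower_semicontinuous g -> convex_efun g ->
  continuous h -> superlinear h -> infconv g h y \is a fin_num.
Proof.
move=> gN gP glsc gcvx hc hs.
by have [p _ ->] := infconv_attained y gN gP glsc gcvx hc hs.
Qed.

(** Convex combinations of minimizers at y1 and y2 are competitors at the
    combined point. *)
Lemma infconv_convex (R : realType) (m : nat) (g : 'rV[R]_m -> \bar R)
    (h : 'rV[R]_m -> R) :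
  avoids_ninfty g -> proper_fun g -> lower_semicontinuous g -> convex_efun g ->
  continuous h -> superlinear h -> convexf h ->
  convexf (fun y => fine (infconv g h y)).
Proof.
move=> gN gP glsc gcvx hc hs hcvx y1 y2 t t01.
have [p1 gp1 ->] := infconv_attained y1 gN gP glsc gcvx hc hs.
have [p2 gp2 ->] := infconv_attained y2 gN gP glsc gcvx hc hs.
set y := _ + _; rewrite -lee_fin fineK; last exact: infconv_fin_num.
apply: le_trans (infconv_le g h y (t *: p1 + (1 - t) *: p2)) _.
have -> : y - (t *: p1 + (1 - t) *: p2) = t *: (y1 - p1) + (1 - t) *: (y2 - p2).
  by apply/rowP => i; rewrite !mxE; ring.
have := gcvx p1 p2 t t01.
rewrite -(fineK gp1) -(fineK gp2) -!EFinM -EFinD /= => hg.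
have hh := hcvx (y1 - p1) (y2 - p2) t t01.
rewrite [leRHS](_ : _ = (t * fine (g p1) + (1 - t) * fine (g p2))%:E +
   (t * h (y1 - p1) + (1 - t) * h (y2 - p2))%:E)%E.
  by apply: leeD; rewrite ?lee_fin.
by rewrite -EFinD; congr EFin; ring.
Qed.

(** A minimizer p at y stays a competitor at every z, so z |-> g p + h (z -
    p) majorizes the envelope with equality at y and inherits the quadratic
    bound of h at y - p. *)
Lemma infconv_touched (R : realType) (m : nat) (g : 'rV[R]_m -> \bar R)
    (h : 'rV[R]_m -> R) (C : R) :
  avoids_ninfty g -> proper_fun g -> lower_semicontinuous g -> convex_efun g ->
  continuous h -> superlinear h -> quadratically_touched h C ->
  quadratically_touched (fun y => fine (infconv g h y)) C.
Proof.
move=> gN gP glsc gcvx hc hs hq y.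
have [p gp ->] := infconv_attained y gN gP glsc gcvx hc hs.
have [w hw] := hq (y - p); exists w => z.
rewrite -lee_fin fineK; last exact: infconv_fin_num.
apply: le_trans (infconv_le g h z p) _.
rewrite -(fineK gp) -EFinD lee_fin /=.
have := hw (z - p); have -> : z - p - (y - p) = z - y.
  by apply/rowP => i; rewrite !mxE; ring.
lra.
Qed.

Lemma infconv_C1 (R : realType) (m : nat) (g : 'rV[R]_m -> \bar R)
    (h : 'rV[R]_m -> R) (C : R) :
  avoids_ninfty g -> proper_fun g -> lower_semicontinuous g -> convex_efun g ->
  continuous h -> superlinear h -> convexf h -> 0 <= C ->
  quadratically_touched h C ->
  continuously_differentiable (fun y => fine (infconv g h y)).
Proof.
move=> gN gP glsc gcvx hc hs hcvx C0 hq.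
apply: (convex_touch_C1 _ C0); first exact: infconv_convex.
exact: infconv_touched.
Qed.

(** * The kernel and its rescalings *)

Lemma convex_function_convexf (R : realType) (m : nat) (omega : 'rV[R]_m -> R) :
  @convex_function R 'rV[R]_m setT omega -> convexf omega.
Proof.
move=> ocvx x y t /andP[t0 t1].
(* The library quantifies over weights packaged with an interval proof. *)
have t01 : Itv.spec (@Itv.num_sem R) (Itv.Real `[0%Z, 1%Z]) t.
  by rewrite /= /Itv.num_sem/= in_itv/= t0 t1 ger0_real.
have := ocvx (Itv.mk t01) x y (mem_set I) (mem_set I).
by rewrite /conv /=.
Qed.

(** By convexity omega z - omega y <= <grad omega z, z - y>, and replacing
    grad omega z by grad omega y costs at most a multiple of |z - y|^2. *)
Lemma lipschitz_grad_touched (R : realType) (m : nat) (omega : 'rV[R]_m -> R) :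
  convexf omega -> (forall x, differentiable omega x) ->
  lipschitz_map (grad omega) ->
  exists2 C, 0 <= C & quadratically_touched omega C.
Proof.
move=> ocvx od [L oL].
exists (m%:R * (`|L| * m%:R)) => [|y]; first by rewrite !mulr_ge0.
exists (grad omega y) => z.
have h1 := convex_grad_le y ocvx (od z).
have h2 := dot_le (grad omega z - grad omega y) (z - y).
have h3 : `|grad omega z - grad omega y| <= `|L| * m%:R * `|z - y|.
  rewrite (le_trans (norm_le_enorm _))// (le_trans (oL _ _))//.
  rewrite -mulrA (le_trans (ler_wpM2r _ (ler_norm L)))// ?sqrtr_ge0//.
  by apply: ler_wpM2l => //; exact: enorm_le_norm.
have h4 : m%:R * `|grad omega z - grad omega y| * `|z - y| <=
    m%:R * (`|L| * m%:R) * `|z - y| ^+ 2.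
  rewrite expr2 [leRHS]mulrA; apply: ler_wpM2r => //.
  by rewrite -[leRHS]mulrA; apply: ler_wpM2l => //.
move: h1 h2; rewrite -(opprB z y) dotNr dotBl; lra.
Qed.

(** Coercivity is silent inside a ball; there the supporting hyperplane at 0
    bounds omega from below. *)
Lemma one_coercive_superlinear (R : realType) (m : nat) (omega : 'rV[R]_m -> R) :
  convexf omega -> differentiable omega 0 -> one_coercive omega ->
  superlinear omega.
Proof.
move=> ocvx od oc A A0; have [r hr] := oc A.
pose r' := Num.max r 0; pose G := grad omega 0.
exists (m%:R * `|G| * r' + A * r' + `|omega 0|) => z.
have r0 : 0 <= r' by rewrite le_max lexx orbT.
have [zr|zr] := leP (enorm z) r'.
  have zr' : `|z| <= r' := le_trans (norm_le_enorm z) zr.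
  have := convex_grad_le z ocvx od; rewrite subr0 -/G => h1.
  have h2 := dot_ge G z.
  have h3 : m%:R * `|G| * `|z| <= m%:R * `|G| * r' by apply: ler_wpM2l.
  have h4 : A * `|z| <= A * r' by apply: ler_wpM2l.
  have := ler_norm (- omega 0); rewrite normrN; lra.
have z0 : 0 < enorm z by apply: le_lt_trans zr.
have /hr : r < enorm z by apply: le_lt_trans zr; rewrite le_max lexx.
rewrite ltr_pdivlMr// => h1.
have h2 : A * `|z| <= A * enorm z by apply: ler_wpM2l => //; exact: norm_le_enorm.
have : 0 <= m%:R * `|G| * r' by rewrite !mulr_ge0.
have : 0 <= A * r' by rewrite mulr_ge0.
have := normr_ge0 (omega 0); lra.
Qed.

Lemma rescale_convex (R : realType) (m : nat) (omega : 'rV[R]_m -> R) (mu : R) :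
  0 <= mu -> convexf omega -> convexf (rescale omega mu).
Proof.
move=> mu0 ocvx x y t t01; rewrite /rescale.
have -> : mu^-1 *: (t *: x + (1 - t) *: y) =
   t *: (mu^-1 *: x) + (1 - t) *: (mu^-1 *: y).
  by apply/rowP => i; rewrite !mxE; ring.
have := ler_wpM2l mu0 (ocvx (mu^-1 *: x) (mu^-1 *: y) t t01).
by congr (_ <= _); ring.
Qed.

Lemma rescale_continuous (R : realType) (m : nat) (omega : 'rV[R]_m -> R) (mu : R) :
  continuous omega -> continuous (rescale omega mu).
Proof.
move=> oc y; apply: (@cvgM R _ (nbhs y) _ (cst mu)
  (fun v : 'rV[R]_m => omega (mu^-1 *: v))); first exact: cvg_cst.
apply: (cvg_comp (fun v : 'rV[R]_m => mu^-1 *: v) omega); last exact: oc.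
exact: scaler_continuous.
Qed.

(** The slope is unchanged while the constant is multiplied by mu, which is
    why the penalty becomes exact in the limit. *)
Lemma rescale_superlinear (R : realType) (m : nat) (omega : 'rV[R]_m -> R)
    (A c mu : R) : (forall z, A * `|z| - c <= omega z) -> 0 < mu ->
  forall z, A * `|z| - mu * c <= rescale omega mu z.
Proof.
move=> oA mu0 z; have := oA (mu^-1 *: z).
rewrite normrZ gtr0_norm ?invr_gt0// => /(ler_wpM2l (ltW mu0)).
rewrite /rescale; congr (_ <= _).
by field; rewrite gt_eqF.
Qed.

Lemma rescale_touched (R : realType) (m : nat) (omega : 'rV[R]_m -> R)
    (C mu : R) : quadratically_touched omega C -> 0 < mu ->
  quadratically_touched (rescale omega mu) (C / mu).
Proof.
move=> oq mu0 y; have [w hw] := oq (mu^-1 *: y); exists w => z.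
have := ler_wpM2l (ltW mu0) (hw (mu^-1 *: z)).
rewrite -scalerBr dotZr normrZ gtr0_norm ?invr_gt0// /rescale.
by congr (_ <= _); field; rewrite gt_eqF.
Qed.

(** * Epi-convergence of the envelopes *)

(** Points u close to z have g u > beta > alpha and omega_mu costs at worst
    a multiple of mu. Points at distance at least e from z pay A |z - u| up to a
    multiple of mu, with the slope A large enough to outweigh the linear
    minorant of g and still exceed alpha. *)
Lemma envelope_lower_limit (R : realType) (m : nat) (g : 'rV[R]_m -> \bar R)
    (omega : 'rV[R]_m -> R) (y : 'rV[R]_m) (alpha : R) :
  avoids_ninfty g -> proper_fun g -> lower_semicontinuous g -> convex_efun g ->
  superlinear omega -> (alpha%:E < g y)%E ->
  \forall z \near y & mu \near (0 : R)^'+,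
    (alpha%:E <= infconv g (rescale omega mu) z)%E.
Proof.
move=> gN gP glsc gcvx os /ereal_dense[beta ab bg].
have [a [b [b0 gab]]] := convex_lsc_linear_minorant gN gP glsc gcvx.
have [V /nbhs_normP[d /= d0 dV] gV] := glsc _ _ bg.
pose e := d / 2; have e0 : 0 < e by rewrite divr_gt0.
(* B dominates alpha + 1 + a + b |z| for every z within e of y, and the choice
   of A makes (A - b) |z - u| >= B as soon as |z - u| >= e. *)
pose B := `|a| + b * (`|y| + e) + `|alpha| + 1.
have B0 : 0 <= B by rewrite !addr_ge0// mulr_ge0// addr_ge0// ltW.
pose A := b + B / e.
have A0 : 0 <= A by rewrite addr_ge0// divr_ge0// ltW.
have [c0 hc0] := os 0 (lexx _).
have [cA hcA] := os A A0.
pose K := `|c0| + `|cA| + 1.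
have K0 : 0 < K by rewrite ltr_wpDl// addr_ge0.
have r0 : 0 < Num.min (beta - alpha) 1 / K by rewrite divr_gt0// lt_min subr_gt0 ab/=.
exists ([set z | `|y - z| < e],
        [set mu | 0 < mu /\ mu < Num.min (beta - alpha) 1 / K]) => /=.
  split; first by apply/(@nbhs_normP _ 'rV[R]_m); exists e.
  apply: filterI; first exact: nbhs_right_gt.
  exact: nbhs_right_lt.
move=> [z mu] /= [yz [mu0]]; rewrite ltr_pdivlMr// lt_min => /andP[mu1 mu2].
have muK k : k <= K -> mu * k <= mu * K by move=> kK; rewrite ler_pM2l.
have c0K : mu * c0 <= mu * K.
  by apply: muK; have := ler_norm c0; have := normr_ge0 cA; rewrite /K; lra.
have cAK : mu * cA <= mu * K.
  by apply: muK; have := ler_norm cA; have := normr_ge0 c0; rewrite /K; lra.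
apply: le_ereal_inf_tmp => _ [u _ <-].
have [zu|zu] := ltP `|z - u| e.
  have gu : (beta%:E < g u)%E.
    apply: gV; apply: dV => /=; have := ler_distD z y u; rewrite /e in yz zu.
    lra.
  have := rescale_superlinear hc0 mu0 (z - u); rewrite mul0r sub0r => h.
  apply: (@le_trans _ _ (beta%:E + (- (mu * c0))%:E)%E).
    by rewrite -EFinD lee_fin; lra.
  by apply: leeD; [exact: ltW|rewrite lee_fin].
have h := rescale_superlinear hcA mu0 (z - u).
apply: (@le_trans _ _ ((- a - b * `|u|)%:E + (A * `|z - u| - mu * cA)%:E)%E).
  rewrite -EFinD lee_fin.
  have h1 : b * `|u| <= b * (`|y| + e + `|z - u|).
    apply: ler_wpM2l => //.
    have := ler_normB z (z - u); rewrite subKr => h2.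
    have := ler_normB y (y - z); rewrite subKr => h3.
    lra.
  have h4 : B <= B / e * `|z - u|.
    by rewrite mulrAC ler_pdivlMr// ler_wpM2l.
  have := ler_norm a; have := ler_norm alpha; rewrite /A in h *.
  move: h4; rewrite {1}/B mulrDl; lra.
by apply: leeD; [exact: gab|rewrite lee_fin].
Qed.

Lemma decreases_to0_at_right (R : realType) (mu : nat -> R) :
  decreases_to0 mu -> mu @ \oo --> (0 : R)^'+.
Proof.
move=> [mu0 mucvg] W W0.
have W1 : \forall k \near \oo, 0 < mu k -> W (mu k) := mucvg _ W0.
by apply: filterS W1 => k; apply; exact: mu0.
Qed.

(** The lower bound, uniform for z near x and t near 0, gives the liminf
    inequality along every sequence; the upper bound makes constant sequences
    recovery sequences. *)
Lemma epi_converges_of_bounds (R : realType) (n : nat) (f : 'rV[R]_n -> \bar R)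
    (s : 'rV[R]_n -> R -> \bar R) (mu : nat -> R) :
  avoids_ninfty f ->
  (forall x (alpha : R), (alpha%:E < f x)%E ->
     \forall z \near x & t \near (0 : R)^'+, (alpha%:E <= s z t)%E) ->
  (forall x t, 0 < t -> (s x t <= f x)%E) ->
  decreases_to0 mu -> epi_converges (fun k x => s x (mu k)) f.
Proof.
move=> fN flow fup mud x; have [mu0 _] := mud; split; last first.
  exists (cst x); first exact: cvg_cst.
  rewrite /limn_esup limf_esupE.
  apply: (@le_trans _ _ (ereal_sup [set s x (mu k) | k in setT])).
    by apply: ereal_inf_lbound; exists setT => //; exact: filterT.
  by apply: ge_ereal_sup => _ [k _ <-]; exact: fup.
move=> xs xsx.
have lim_ge (alpha : R) : (alpha%:E < f x)%E ->
    (alpha%:E <= limn_einf (fun k => s (xs k) (mu k)))%E.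
  move=> /flow[[V W] /= [Vx W0] VW].
  rewrite -[limn_einf _]/(limf_einf _ _) limf_einfE.
  apply: le_ereal_sup_tmp.
  exists (ereal_inf [set s (xs k) (mu k) | k in [set k | V (xs k) /\ W (mu k)]]).
    exists [set k | V (xs k) /\ W (mu k)] => //.
    apply: filterI; first exact: xsx.
    exact: (decreases_to0_at_right mud W0).
  by apply: le_ereal_inf_tmp => _ [k [Vk Wk] <-]; exact: (VW (_, _)).
rewrite leNgt; apply/negP => lt_lim.
case: (limn_einf _) lim_ge lt_lim => [r| |] lim_ge.
- by move=> /ereal_dense[b rb /lim_ge]; rewrite lee_fin leNgt rb.
- by move=> h; have := lt_le_trans h (leey _); rewrite ltxx.
- move=> _; have [b bf] : exists b : R, (b%:E < f x)%E.
    case: (f x) (fN x) => [r _|_|//]; last by exists 0; exact: ltry.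
    by exists (r - 1); rewrite lte_fin; lra.
  by have := lim_ge _ bf.
Qed.

(** * Limits of gradients are subgradients *)

Lemma diff_map_expansion (R : realType) (n m : nat) (H : 'rV[R]_n -> 'rV[R]_m)
    (x : 'rV[R]_n) : differentiable H x -> forall e : R, 0 < e ->
  \forall u \near (0 : 'rV[R]_n), `|H (x + u) - H x - u *m 'J H x| <= e * `|u|.
Proof.
move=> dH e e0; have /eqaddoP/(_ _ e0) := diff_locally dH.
apply: filterS => u /=.
by rewrite !fctE opprD addrA [u + x]addrC /jacobian mul_rV_lin1.
Qed.

(** Compose the global subgradient inequality of g with the first-order
    expansion of H. *)
Lemma regular_subdiff_comp (R : realType) (n m : nat) (g : 'rV[R]_m -> \bar R)
    (H : 'rV[R]_n -> 'rV[R]_m) (x : 'rV[R]_n) (w : 'rV[R]_m) :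
  avoids_ninfty g -> dom g (H x) -> differentiable H x ->
  (forall u, dom g u -> fine (g (H x)) + dot w (u - H x) <= fine (g u)) ->
  regular_subdiff (g \o H) x (w *m ('J H x)^T).
Proof.
move=> gN gx dH gw; split=> // e e0.
have gfin u : dom g u -> g u \is a fin_num.
  by move=> gu; rewrite fin_numE gt_eqF//= lt_eqF.
have M0 : 0 < m%:R * `|w| + 1 by rewrite ltr_wpDl// mulr_ge0.
have := diff_map_expansion dH (divr_gt0 e0 M0).
move=> h; apply/nbhs0P; apply: filterS h => u hu /=.
rewrite [x + u]addrC addrK [u + x]addrC.
have [gu|] := ltP (g (H (x + u))) +oo%E; last by rewrite leye_eq => /eqP ->; rewrite leey.
rewrite -(fineK (gfin _ gu)) -(fineK (gfin _ gx)) -EFinD lee_fin.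
apply: le_trans (gw _ gu); rewrite lerD2l dot_mulmxl.
rewrite -[H (x + u) - H x](subrK (u *m 'J H x)) [dot w (_ + _)]dotDr.
set d := H (x + u) - _ - _ in hu *.
have h1 := dot_ge w d.
have h2 : m%:R * `|w| * `|d| <= (m%:R * `|w| + 1) * (e / (m%:R * `|w| + 1) * `|u|).
  by apply: ler_pM; rewrite ?mulr_ge0// lerDl.
have h3 : (m%:R * `|w| + 1) * (e / (m%:R * `|w| + 1) * `|u|) = e * `|u|.
  by field; rewrite gt_eqF.
have h4 : e * `|u| <= e * enorm u.
  by apply: ler_wpM2l; [exact: ltW|exact: norm_le_enorm].
lra.
Qed.

(** Passing to an ultrafilter on the index set replaces the extraction of
    convergent subsequences: all bounded sequences converge along it
    simultaneously. *)
Lemma ultra_cvg_compact (T : Type) (V : topologicalType) (U : set_system T)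
    (f : T -> V) (A : set V) : UltraFilter U -> compact A ->
  (forall x, A (f x)) -> exists2 p, A p & f @ U --> p.
Proof.
move=> UU; rewrite compact_ultra => cA fA.
have PU : ProperFilter U  by exact: ultra_proper.
have ultraf : UltraFilter (f @ U).
  split; first exact: fmap_proper_filter.
  move=> G PG FG; apply/seteqP; split=> // B GB.
  have [//|nB] := in_ultra_setVsetC (f @^-1` B) UU.
  have GC : G (~` B) by apply: FG.
  by have [x [Bx nBx]] := filter_ex (filterI GB GC).
have [p [Ap fp]] := cA _ ultraf (filterS (fun x _ => fA x) (@filterT _ U _)).
by exists p.
Qed.

(** The multipliers ws are not known to be bounded. Scaling by lam = 1 / (1
    + |ws|) makes both lam and lam ws converge, to l and z with |z| = 1 - l, and
    every hypothesis is homogeneous enough to survive the limit. If l = 0, then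
    z is a unit vector excluded by the qualification; otherwise z / l is the
    multiplier. *)
Lemma multiplier_limit (R : realType) (n m : nat) (g : 'rV[R]_m -> \bar R)
    (ybar : 'rV[R]_m) (ys ws : nat -> 'rV[R]_m) (es : nat -> R)
    (Js : nat -> 'M[R]_(n, m)) (J : 'M[R]_(n, m)) (v : 'rV[R]_n) :
  g ybar \is a fin_num -> ys @ \oo --> ybar -> Js @ \oo --> J ->
  ws k *m (Js k)^T @[k --> \oo] --> v ->
  (forall alpha : R, (alpha%:E < g ybar)%E ->
     \forall k \near \oo, alpha <= es k) ->
  (forall k u, dom g u -> es k + dot (ws k) (u - ys k) <= fine (g u)) ->
  normal_cone (dom g) ybar `&` [set w | w *m J^T = 0] = [set 0] ->
  exists2 w, v = w *m J^T & forall u, dom g u ->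
    fine (g ybar) + dot w (u - ybar) <= fine (g u).
Proof.
move=> gy ysy JsJ wsv eslow esub qual.
have [U [UU ooU]] := ultraFilterLemma (@eventually_filter).
have PU : ProperFilter U  by exact: ultra_proper.
pose lam k := (1 + `|ws k|)^-1; pose zs k := lam k *: ws k.
have w1 k : 0 < 1 + `|ws k| by rewrite ltr_pwDl.
have lam0 k : 0 < lam k by rewrite invr_gt0.
have zsE k : `|zs k| = 1 - lam k.
  rewrite /zs normrZ gtr0_norm//.
  by have : lam k * (1 + `|ws k|) = 1 by [rewrite mulVf// gt_eqF|]; lra.
have [l /= l01 laml] : exists2 l, [set` `[(0 : R), 1]] l & lam @ U --> l.
  apply: ultra_cvg_compact => [|k]; first exact: segment_compact.
  rewrite /= in_itv/= (ltW (lam0 k))/=.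
  by have := normr_ge0 (zs k); rewrite zsE subr_ge0.
have {l01}[l0 l1] : 0 <= l /\ l <= 1 by move: l01; rewrite in_itv/= => /andP[].
have [z _ zsz] : exists2 z, [set u : 'rV[R]_m | `|u - 0| <= 1] z & zs @ U --> z.
  apply: ultra_cvg_compact => [|k]; first exact: compact_norm_ball.
  by rewrite /= subr0 zsE gerBl ltW.
have normz : `|z| = 1 - l.
  have h1 : `|zs k| @[k --> U] --> `|z| by exact: cvg_norm.
  have h2 : `|zs k| @[k --> U] --> 1 - l.
    under eq_fun do rewrite zsE.
    by apply: cvgB; [exact: cvg_cst|exact: laml].
  exact: (cvg_unique (@norm_hausdorff _ _) h1 h2).
have toU (T : topologicalType) (f : nat -> T) (a : T) : f @ \oo --> a -> f @ U --> a.
  by move=> fa P Pa; apply: ooU; exact: fa.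
have zJ : l *: v = z *m J^T.
  have h1 : zs k *m (Js k)^T @[k --> U] --> z *m J^T.
    by apply: cvg_mulmx => //; apply: cvg_trmx; exact: toU.
  have h2 : zs k *m (Js k)^T @[k --> U] --> l *: v.
    under eq_fun do rewrite /zs -scalemxAl.
    by apply: cvgZ => //; exact: toU.
  exact: (cvg_unique (@norm_hausdorff _ _) h2 h1).
have ineq u : dom g u -> l * fine (g ybar) + dot z (u - ybar) <= l * fine (g u).
  move=> gu; apply/ler_addgt0Pr => e e0.
  have h1 : lam k * (fine (g ybar) - e) + dot (zs k) (u - ys k) @[k --> U] -->
      l * (fine (g ybar) - e) + dot z (u - ybar).
    apply: cvgD; first by apply: (@cvgM R _ U _ lam (cst _)) => //; exact: cvg_cst.
    apply: cvg_dot => //.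
    apply: (@cvgB R 'rV[R]_m _ U _ (cst u) ys); first exact: cvg_cst.
    exact: toU.
  have h2 : lam k * fine (g u) @[k --> U] --> l * fine (g u).
    by apply: (@cvgM R _ U _ lam (cst _)) => //; exact: cvg_cst.
  have : l * (fine (g ybar) - e) + dot z (u - ybar) <= l * fine (g u).
    apply: ler_cvg_to h1 h2 _.
    have : \forall k \near \oo, fine (g ybar) - e <= es k.
      by apply: eslow; rewrite -(fineK gy) lte_fin; lra.
    move=> /ooU; apply: filterS => k esk.
    rewrite /zs dotZl -mulrDr; apply: ler_wpM2l; first exact: ltW.
    by apply: le_trans (esub k u gu); rewrite lerD2r.
  have : l * e <= e by rewrite ler_piMl// ltW.
  lra.
have [lE|lN] := eqVneq l 0.
  have : (normal_cone (dom g) ybar `&` [set w | w *m J^T = 0]) z.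
    split=> /=; last by rewrite -zJ lE scale0r.
    by move=> u /ineq; rewrite lE !mul0r add0r.
  rewrite qual /= => z0; move: normz; rewrite z0 lE normr0; lra.
have l_gt0 : 0 < l by rewrite lt_neqAle eq_sym lN.
exists (l^-1 *: z) => [|u gu].
  by rewrite -scalemxAl -zJ scalerA mulVf// scale1r.
rewrite -(ler_pM2l l_gt0) mulrDr dotZl mulrA mulfV// mul1r.
exact: ineq.
Qed.

(** * Subgradients are limits of gradients *)

(** A critical point of the smoothing minus v0 plus the penalty c |z - x0|^2
    is found inside a ball of radius d: on the sphere the penalty c d^2 beats
    the error of the subgradient inequality, while the product c d stays of
    order eps, so that the gradient of the penalty is small. *)
Lemma regular_subdiff_approx (R : realType) (n : nat) (f : 'rV[R]_n -> \bar R)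
    (s : 'rV[R]_n -> R -> \bar R) (x0 v0 : 'rV[R]_n) (eps : R) :
  avoids_ninfty f ->
  (forall x (alpha : R), (alpha%:E < f x)%E ->
     \forall z \near x & t \near (0 : R)^'+, (alpha%:E <= s z t)%E) ->
  (forall x t, 0 < t -> (s x t <= f x)%E) ->
  (forall t, 0 < t -> (forall x, s x t \is a fin_num) /\
     (forall x, differentiable (fun z => fine (s z t)) x)) ->
  regular_subdiff f x0 v0 -> 0 < eps ->
  exists x t, [/\ `|x - x0| <= eps, 0 < t, t <= eps &
    `|grad (fun z => fine (s z t)) x - v0| <= eps].
Proof.
move=> fN flow fup sdiff [fx0 fv0] eps0.
have fx0f : f x0 \is a fin_num by rewrite fin_numE gt_eqF//= lt_eqF.
pose N : R := n%:R + 1; have N0 : 0 < N by rewrite ltr_wpDl.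
(* N bounds the ratio of the two norms, so on the sphere the error term is at
   most eps d / 8, half of the penalty c d^2 = eps d / 4. *)
pose e1 := eps / (8 * N).
have e10 : 0 < e1 by rewrite divr_gt0// mulr_gt0.
have e1N : e1 * N = eps / 8 by rewrite /e1; field; rewrite gt_eqF.
have /(@nbhs_normP _ 'rV[R]_n)[r /= r0 fr] := fv0 e1 e10.
pose d := Num.min eps (r / 2).
have d0 : 0 < d by rewrite lt_min eps0 divr_gt0.
have deps : d <= eps by rewrite ge_min lexx.
have dr : d < r by rewrite gt_min; apply/orP; right; lra.
pose c := eps / 4 / d.
have c0 : 0 < c by rewrite !divr_gt0.
have cd : c * d = eps / 4 by rewrite /c divfK// gt_eqF.
have sphere z : `|z - x0| = d ->
    ((fine (f x0) + dot v0 (z - x0) - 3 / 4 * (c * d ^+ 2))%:E < f z)%E.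
  move=> zd.
  have /fr : `|x0 - z| < r by rewrite distrC zd.
  apply: lt_le_trans; rewrite -(fineK fx0f) -EFinD lte_fin.
  have h1 : e1 * enorm (z - x0) <= e1 * (N * d).
    apply: ler_wpM2l; first exact: ltW.
    rewrite (le_trans (enorm_le_norm _))// zd; apply: ler_wpM2r; first exact: ltW.
    by rewrite lerDl.
  have h2 : e1 * (N * d) = eps / 8 * d by rewrite mulrA e1N.
  have h3 : c * d ^+ 2 = eps / 4 * d by rewrite expr2 mulrA cd.
  have h4 : 0 < eps * d by rewrite mulr_gt0.
  rewrite h3 /=; lra.
have cd2 : 0 < c * d ^+ 2 by rewrite mulr_gt0// exprn_gt0.
have above : \forall t \near (0 : R)^'+, forall z, `|z - x0| = d ->
    ((fine (f x0) + dot v0 (z - x0) - c * d ^+ 2)%:E < s z t)%E.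
  have /compact_near_coveringP := @compact_norm_sphere R n x0 d.
  apply => z /= zd.
  have [[V W] /= [Vz W0] VW] := flow z _ (sphere z zd).
  have dotc : dot v0 (z' - x0) @[z' --> z] --> dot v0 (z - x0).
    apply: (@cvg_dot R n _ (nbhs z) _ (cst v0)); first exact: cvg_cst.
    by apply: (@cvgB R 'rV[R]_n _ (nbhs z) _ id (cst x0));
      [exact: cvg_id|exact: cvg_cst].
  have : dot v0 (z - x0) < dot v0 (z - x0) + c * d ^+ 2 / 4 by lra.
  move=> /(cvgr_lt _ dotc) V'z.
  exists (V `&` [set z' | dot v0 (z' - x0) < dot v0 (z - x0) + c * d ^+ 2 / 4], W).
    by split=> //; exact: filterI.
  move=> [z' t] /= [[Vz' h] Wt].
  apply: lt_le_trans (VW (z', t) (conj Vz' Wt)); rewrite lte_fin; lra.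
have [t [Wsphere t0 teps]] : exists t, [/\ forall z, `|z - x0| = d ->
    ((fine (f x0) + dot v0 (z - x0) - c * d ^+ 2)%:E < s z t)%E, 0 < t & t <= eps].
  near (0 : R)^'+ => t; exists t; split.
  - by near: t.
  - by near: t; exact: nbhs_right_gt.
  - by near: t; exact: nbhs_right_le.
have [sfin sd] := sdiff t t0.
pose S z := fine (s z t).
pose psi z := S z - dot v0 (z - x0) + c * dot (z - x0) (z - x0).
have psic : continuous psi.
  move=> z.
  have subc : z' - x0 @[z' --> z] --> z - x0.
    by apply: (@cvgB R 'rV[R]_n _ (nbhs z) _ id (cst x0));
      [exact: cvg_id|exact: cvg_cst].
  apply: (@cvgD R R _ (nbhs z) _ (fun z => S z - dot v0 (z - x0))
    (fun z => c * dot (z - x0) (z - x0))).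
    apply: (@cvgB R R _ (nbhs z) _ S (fun z => dot v0 (z - x0))).
      exact: differentiable_continuous (sd z).
    by apply: (@cvg_dot R n _ (nbhs z) _ (cst v0)) => //; exact: cvg_cst.
  apply: (@cvgM R _ (nbhs z) _ (cst c)); first exact: cvg_cst.
  exact: cvg_dot.
have K0 : [set u : 'rV[R]_n | `|u - x0| <= d] !=set0.
  by exists x0; rewrite /= subrr normr0 ltW.
have [x] := EVT_min_rV K0 (@compact_norm_ball R n x0 d)
  (continuous_subspaceT psic).
rewrite inE /= => xd xmin.
have xd' : `|x - x0| < d.
  rewrite lt_neqAle xd andbT; apply/negP => /eqP xdE.
  have := Wsphere x xdE; rewrite -(fineK (sfin x)) lte_fin -/(S x) => h1.
  have : psi x <= psi x0 by apply: xmin; rewrite inE /= subrr normr0 ltW.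
  rewrite /psi subrr !dot0r mulr0 addr0 subr0.
  have : S x0 <= fine (f x0).
    by rewrite -lee_fin /S !fineK//; exact: fup.
  have : c * d ^+ 2 <= c * dot (x - x0) (x - x0).
    by rewrite ler_pM2l// -xdE sqr_norm_le_dot.
  lra.
exists x, t; split=> //; first exact: le_trans deps.
(* The stationarity condition at the interior minimizer x. *)
suff <- : v0 - (2 * c) *: (x - x0) = grad S x.
  rewrite addrAC subrr add0r normrN normrZ gtr0_norm; last exact: mulr_gt0.
  have : 2 * c * `|x - x0| <= 2 * (c * d).
    by rewrite mulrA; apply: ler_wpM2l; [rewrite mulr_ge0// ltW|].
  lra.
apply: dot_delta_le => u.
apply: (@derivative_ge _ _ _ _ _ _ (c * dot u u)) => //.
  by rewrite mulr_ge0 ?dot_ge0// ltW.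
have u1 : 0 < `|u| + 1 by rewrite ltr_wpDl.
near=> tau.
have tau0 : 0 < tau by near: tau; exact: nbhs_right_gt.
have tauu : tau < (d - `|x - x0|) / (`|u| + 1).
  by near: tau; apply: nbhs_right_lt; rewrite divr_gt0// subr_gt0.
have : psi x <= psi (x + tau *: u).
  apply: xmin; rewrite inE /= [x + _]addrC -addrA.
  rewrite (le_trans (ler_normD _ _))// normrZ gtr0_norm//.
  by move: tauu; rewrite ltr_pdivlMr//; lra.
rewrite /psi (_ : x + tau *: u - x0 = (x - x0) + tau *: u); last by rewrite addrAC.
rewrite !(dotDl (x - x0)) !(dotDr (x - x0)) (dotBl v0) !dotZl !dotZr.
rewrite (dotC u (x - x0)) !expr2 => h.
lra.
Unshelve. all: by end_near. Qed.

(** Each regular subgradient in the defining sequence is replaced by a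
    gradient of the smoothing at distance at most 1 / (k + 1). *)
Lemma limiting_subdiff_sub_Limsup_grad (R : realType) (n : nat) (f : 'rV[R]_n -> \bar R)
    (s : 'rV[R]_n -> R -> \bar R) (xbar : 'rV[R]_n) :
  avoids_ninfty f ->
  (forall x (alpha : R), (alpha%:E < f x)%E ->
     \forall z \near x & t \near (0 : R)^'+, (alpha%:E <= s z t)%E) ->
  (forall x t, 0 < t -> (s x t <= f x)%E) ->
  (forall t, 0 < t -> (forall x, s x t \is a fin_num) /\
     (forall x, differentiable (fun z => fine (s z t)) x)) ->
  limiting_subdiff f xbar `<=` Limsup_grad s xbar.
Proof.
move=> fN flow fup sdiff v [xs [vs [xsx _ reg vsv]]].
have /choice[p hp] : forall k, exists p : 'rV[R]_n * R,
    [/\ `|p.1 - xs k| <= harmonic k, 0 < p.2, p.2 <= harmonic k &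
      `|grad (fun z => fine (s z p.2)) p.1 - vs k| <= harmonic k].
  move=> k.
  have [x [t ?]] := regular_subdiff_approx fN flow fup sdiff (reg k)
    (harmonic_gt0 k).
  by exists (x, t).
have near_cvg (a b : nat -> 'rV[R]_n) (l : 'rV[R]_n) : a @ \oo --> l ->
    (forall k, `|b k - a k| <= harmonic k) -> b @ \oo --> l.
  move=> al ab.
  have h0 : (b \- a) @ \oo --> (0 : 'rV[R]_n).
    apply/norm_cvg0P; apply: (squeeze_cvgr _ (cvg_cst 0) (@cvg_harmonic R)).
    by near=> k; rewrite /= normr_ge0 ab.
  have -> : b = (b \- a) + a by apply/funext => k; rewrite fctE subrK.
  by rewrite -(add0r l); exact: cvgD.
exists (fun k => (p k).1), (fun k => (p k).2); split.
- by apply: near_cvg xsx _ => k; case: (hp k).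
- split=> [k|]; first by case: (hp k).
  apply: (squeeze_cvgr _ (cvg_cst 0) (@cvg_harmonic R)).
  by near=> k; case: (hp k) => _ /ltW -> -> _.
- by apply: near_cvg vsv _ => k; case: (hp k).
Unshelve. all: by end_near. Qed.

(** * The smoothing of a convex composite function *)

Unset Implicit Arguments.

Theorem corollary5p8 (R : realType) (n m : nat)
    (g : 'rV[R]_m -> \bar R) (H : 'rV[R]_n -> 'rV[R]_m) (omega : 'rV[R]_m -> R)
    (g_ninfty : avoids_ninfty g)
    (g_proper : proper_fun g)
    (g_lsc : lower_semicontinuous g)
    (g_convex : convex_efun g)
    (H_C1 : continuously_differentiable_map H)
    (omega_convex : @convex_function R 'rV[R]_m setT omega)
    (omega_C1 : continuously_differentiable omega)
    (omega_lip : lipschitz_map (grad omega))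
    (omega_coercive : one_coercive omega)
    (omega0 : omega 0 <= 0) :
  let s_g := fun (y : 'rV[R]_m) (mu : R) => infconv g (rescale omega mu) y in
  let s_f := fun (x : 'rV[R]_n) (mu : R) => s_g (H x) mu in
  let f := g \o H in
  epi_smoothing f s_f /\
  (forall xbar : 'rV[R]_n, dom f xbar -> BCQ g H xbar ->
    Limsup_grad s_f xbar = limiting_subdiff f xbar).
Proof.
move=> s_g s_f f.
have [Hd HJ] := H_C1; have [od _] := omega_C1.
have Hc x : {for x, continuous H} := differentiable_continuous (Hd x).
have oc : continuous omega by move=> y; exact: differentiable_continuous (od y).
have ocvx := convex_function_convexf omega_convex.
have os := one_coercive_superlinear ocvx (od 0) omega_coercive.
have [C C0 oq] := lipschitz_grad_touched ocvx od omega_lip.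
have rc mu : continuous (rescale omega mu) := rescale_continuous oc.
have rcvx mu : 0 < mu -> convexf (rescale omega mu).
  by move=> mu0; apply: rescale_convex => //; exact: ltW.
have rs mu : 0 < mu -> superlinear (rescale omega mu).
  move=> mu0 A A0; have [c hc] := os A A0; exists (mu * c).
  exact: rescale_superlinear.
have sfin y mu : 0 < mu -> s_g y mu \is a fin_num.
  by move=> mu0; apply: infconv_fin_num => //; exact: rs.
have sC1 mu : 0 < mu -> continuously_differentiable (fun y => fine (s_g y mu)).
  move=> mu0; apply: (@infconv_C1 _ _ _ _ (C / mu)) => //.
  - exact: rs.
  - exact: rcvx.
  - by rewrite divr_ge0// ltW.
  - exact: rescale_touched.
have scvx mu : 0 < mu -> convexf (fun y => fine (s_g y mu)).
  by move=> mu0; apply: infconv_convex => //; [exact: rs|exact: rcvx].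
have sle y mu : 0 < mu -> (s_g y mu <= g y)%E.
  move=> mu0; apply: le_trans (infconv_le _ _ y y) _.
  rewrite subrr /rescale scaler0 -[leRHS]adde0; apply: leeD => //.
  by rewrite lee_fin mulr_ge0_le0// ltW.
have sgrad mu x : 0 < mu ->
    differentiable (fun z => fine (s_f z mu)) x /\
    grad (fun z => fine (s_f z mu)) x =
      grad (fun y => fine (s_g y mu)) (H x) *m ('J H x)^T.
  move=> mu0; have [sd _] := sC1 mu mu0.
  exact: (@grad_comp _ _ _ (fun y => fine (s_g y mu)) H x (Hd x) (sd (H x))).
have fN : avoids_ninfty f by move=> x; exact: g_ninfty.
have flow x (alpha : R) : (alpha%:E < f x)%E ->
    \forall z \near x & t \near (0 : R)^'+, (alpha%:E <= s_f z t)%E.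
  move=> /(envelope_lower_limit g_ninfty g_proper g_lsc g_convex os).
  move=> [[V W] /= [VH W0] VW]; exists (H @^-1` V, W) => /=.
    by split=> //; exact: (Hc x).
  by move=> [z t] /= [Vz Wt]; exact: (VW (_, _)).
have fup x t : 0 < t -> (s_f x t <= f x)%E by exact: sle.
split.
  split=> //.
  - move=> x a /(g_lsc (H x))[V VH gV]; exists (H @^-1` V); first exact: (Hc x).
    by move=> z; exact: gV.
  - by move=> mu mud; exact: epi_converges_of_bounds.
  - move=> mu mu0; split; first by move=> x; exact: sfin.
    split; first by move=> x; have [] := sgrad mu x mu0.
    have -> : grad (fun x => fine (s_f x mu)) =
        fun x => grad (fun y => fine (s_g y mu)) (H x) *m ('J H x)^T.
      by apply/funext => x; have [] := sgrad mu x mu0.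
    move=> x; apply: (@cvg_mulmx _ _ _ _ _ (nbhs x) _
      (fun z => grad (fun y => fine (s_g y mu)) (H z)) (fun z => ('J H z)^T));
      last exact: (@cvg_trmx _ _ _ _ (nbhs x) _ _ _ (HJ x)).
    have [_ gc] := sC1 mu mu0.
    exact: (cvg_comp H _ (Hc x) (gc (H x))).
move=> xbar fx qual; apply/seteqP; split; last first.
  apply: limiting_subdiff_sub_Limsup_grad => // t t0; split=> x; first exact: sfin.
  by have [] := sgrad t x t0.
move=> v [xs [mu [xsx mud gradv]]]; have [mu0 _] := mud.
have gfin u : dom g u -> g u \is a fin_num.
  by move=> gu; rewrite fin_numE gt_eqF ?lt_eqF//; exact: g_ninfty.
have gH := gfin _ fx.
have HxsH : H (xs k) @[k --> \oo] --> H xbar := cvg_comp xs H xsx (Hc xbar).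
(* The values e_(mu_k) (H x_k) play the role of es. *)
have [| | |w vE wsub] := @multiplier_limit _ _ _ _ _ (fun k => H (xs k))
    (fun k => grad (fun y => fine (s_g y (mu k))) (H (xs k)))
    (fun k => fine (s_g (H (xs k)) (mu k))) (fun k => 'J H (xs k)) ('J H xbar) v
    gH HxsH (cvg_comp xs _ xsx (HJ xbar)) _ _ _ qual.
- by under eq_fun do rewrite -(sgrad _ _ (mu0 _)).2.
- move=> alpha /(flow xbar)[[V W] /= [Vx W0] VW].
  near=> k; rewrite -lee_fin fineK; last exact: sfin.
  apply: (VW (xs k, mu k)); split => /=; near: k; first exact: xsx.
  exact: (decreases_to0_at_right mud W0).
- move=> k u gu; have [sd _] := sC1 _ (mu0 k).
  apply: le_trans (convex_grad_le u (scvx _ (mu0 k)) (sd _)) _.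
  rewrite -lee_fin fineK; last by apply: sfin; exact: mu0.
  by rewrite fineK; [apply: sle; exact: mu0|exact: gfin].
have vreg : regular_subdiff f xbar v.
  by rewrite vE; exact: regular_subdiff_comp.
exists (cst xbar), (cst v); split.
- exact: cvg_cst.
- exact: (@cvg_cst _ (f xbar)).
- by move=> k; exact: vreg.
- exact: cvg_cst.
Unshelve. all: by end_near. Qed.
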